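(* Let $n$ be a positive integer. Every $n\times n$ matrix constructed by Algorithm NCON2 (described in the context) is an N-matrix of the second category. Conversely, every $n\times n$ N-matrix of the second category can be constructed by Algorithm NCON2, i.e., it is the output of the algorithm for some admissible sequence of choices.
   Context: A real $n\times n$ matrix $A=[a_{ij}]$ is an N-matrix if all of its principal minors (determinants of submatrices with rows and columns indexed by the same nonempty subset of $\{1,\dots,n\}$) are negative; it is a P-matrix if all of its principal minors are positive. An N-matrix is of the second category if $a_{ij}<0$ for all $i,j$. Inequalities for vectors and matrices are entrywise. Algorithm NCON2 (nondeterministic; constructs an $n\times n$ matrix): 1. Choose a $1\times1$ real matrix $A_1<0$. 2. For $i=1,\dots,n-1$, given the $i\times i$ matrix $A_i$: (a) choose $a_i\in\mathbb{R}$ with $a_i<0$ and $x^{(i)},y^{(i)}\in\mathbb{R}^i$ with $x^{(i)}<0$, $y^{(i)}<0$ such that $A_i-\frac{1}{a_i}x^{(i)}{y^{(i)}}^T$ is a P-matrix; (b) form the $(i+1)\times(i+1)$ matrix $A_{i+1}=\begin{bmatrix}A_i & x^{(i)}\\ {y^{(i)}}^T & a_i\end{bmatrix}$. 3. Output $A=A_n$. A matrix is ''constructed by NCON2'' if it equals the output $A_n$ for some sequence of choices satisfying the requirements in steps 1 and 2. *)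

(* Defs.v *)
From HB Require Import structures.
From mathcomp Require Import all_boot all_order all_algebra.
From mathcomp Require Import reals.

Set Implicit Arguments.
Unset Strict Implicit.
Unset Printing Implicit Defensive.

Import Order.TTheory GRing.Theory Num.Theory.

Local Open Scope ring_scope.

(* [enum_val] lists the elements of [S] in increasing order. *)
Definition principal_submx (R : Type) (n : nat) (S : {set 'I_n})
    (A : 'M[R]_n) : 'M[R]_#|S| :=
  mxsub (fun i : 'I_#|S| => enum_val i) (fun j : 'I_#|S| => enum_val j) A.

Definition principal_minor (R : realFieldType) (n : nat) (S : {set 'I_n})
    (A : 'M[R]_n) : R :=
  \det (principal_submx S A).

Definition mx_neg (R : realFieldType) (m n : nat) (A : 'M[R]_(m, n)) : Prop :=
  forall i j, A i j < 0.

Definition N_matrix (R : realFieldType) (n : nat) (A : 'M[R]_n) : Prop :=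
  forall S : {set 'I_n}, S != set0 -> principal_minor S A < 0.

Definition P_matrix (R : realFieldType) (n : nat) (A : 'M[R]_n) : Prop :=
  forall S : {set 'I_n}, S != set0 -> 0 < principal_minor S A.

Definition N_matrix_second_category (R : realFieldType) (n : nat)
    (A : 'M[R]_n) : Prop :=
  N_matrix A /\ mx_neg A.

(* A derivation of [NCON2 A] is a run of the nondeterministic algorithm with
   output [A]: its leaf is the choice of the initial 1 x 1 matrix, and each
   later node is one pass through the loop with its choice of [a], [x], [y]. *)
Inductive NCON2 (R : realFieldType) : forall n : nat, 'M[R]_n -> Prop :=
| NCON2_start (A1 : 'M[R]_1) :
    mx_neg A1 -> NCON2 A1
| NCON2_step (i : nat) (A : 'M[R]_i) (a : R) (x y : 'cV[R]_i) :
    NCON2 A ->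
    a < 0 -> mx_neg x -> mx_neg y ->
    P_matrix (A - a^-1 *: (x *m y^T)) ->
    NCON2 (block_mx A x y^T a%:M : 'M[R]_(i + 1)).

(* Main.v *)
Require Import Defs.
From mathcomp Require Import all_boot all_order all_algebra.
From mathcomp Require Import perm.
From mathcomp Require Import reals.

(** Write [M] for the bordered matrix with blocks [A], [x], [y^T], [a], where
[a < 0], and [C = A - a^-1 x y^T] for the Schur complement of its last pivot.
A principal minor of [M] that avoids the last index is a principal minor of
[A]; one that uses the last index and an index set [T] of [A] equals [a] times
the [T]-minor of [C], because the Schur complement by the last pivot commutes
with the deletion of the other indices ([principal_minor_lshift],
[principal_minor_last]).  As [a] is negative, all principal minors of [M] are
negative if and only if those of [A] are negative and those of [C] are positive
([N_matrix_bordered]).  So one pass of the loop is exactly one bordering step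
between N-matrices of the second category, and both directions follow by
induction on the size: forwards along the run, backwards by cutting off the
last row and column.

The index sets of minors are enumerated in increasing order, whereas the block
structure of [M] enumerates them block by block.  [det_mxsub_inj] reconciles
the two: a principal minor may be computed with any injective enumeration of
its index set. *)

Set Implicit Arguments.
Unset Strict Implicit.
Unset Printing Implicit Defensive.

Import Order.TTheory GRing.Theory Num.Theory.

Local Open Scope ring_scope.

(** The same permutation acts on rows and on columns, so its sign cancels.  The
two sizes are kept apart because a cardinal such as [#|S|] is only provably
equal to the intended size. *)
Lemma det_mxsub_reindex (R : comPzRingType) (k m : nat) (h : 'I_k -> 'I_m)
    (B : 'M[R]_m) :
  k = m -> injective h -> \det (mxsub h h B) = \det B.
Proof.
move=> km; subst m => h_inj.
have -> : mxsub h h B = row_perm (perm h_inj) (col_perm (perm h_inj) B).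
  by apply/matrixP => i j; rewrite !mxE !permE.
rewrite row_permE col_permE !det_mulmx !det_perm odd_permV mulrCA -signr_addb.
by rewrite addbb mulr1.
Qed.

Lemma det_mxsub_inj (R : realFieldType) (n k : nat) (f : 'I_k -> 'I_n)
    (S : {set 'I_n}) (A : 'M[R]_n) :
  injective f -> f @: 'I_k = S -> \det (mxsub f f A) = principal_minor S A.
Proof.
move=> f_inj fS; have f_in i : f i \in S by rewrite -fS imset_f.
pose rank i := enum_rank_in (f_in i) (f i).
have rankK i : enum_val (rank i) = f i by rewrite enum_rankK_in.
rewrite /principal_minor -(@det_mxsub_reindex _ _ _ rank).
- by congr (\det _); apply/matrixP => i j; rewrite !mxE !rankK.
- by rewrite -fS card_imset ?card_ord.
- by move=> i j /(congr1 enum_val); rewrite !rankK; apply: f_inj.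
Qed.

Lemma principal_minor0 (R : realFieldType) (n : nat) (A : 'M[R]_n) :
  principal_minor set0 A = 1.
Proof.
have f0 : 'I_0 -> 'I_n by case.
rewrite -(@det_mxsub_inj _ _ _ f0) ?det_mx00 //; first by case.
by apply/setP => i; rewrite inE; apply/imsetP => -[[]].
Qed.

(** Clearing the last row with the pivot [a] by a unipotent column operation
turns the bordered matrix into a block triangular one. *)
Lemma det_bordered (R : fieldType) (k : nat) (A : 'M[R]_k) (a : R)
    (x y : 'cV[R]_k) :
  a != 0 ->
  \det (block_mx A x y^T a%:M) = a * \det (A - a^-1 *: (x *m y^T)).
Proof.
move=> a0.
have -> : block_mx A x y^T a%:M =
    block_mx (A - a^-1 *: (x *m y^T)) x 0 a%:M *m
    block_mx 1%:M 0 (a^-1 *: y^T) 1%:M.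
  rewrite mulmx_block !mulmx1 !mulmx0 !add0r -scalemxAr subrK.
  by rewrite mul_scalar_mx scalerA mulfV // scale1r.
by rewrite det_mulmx det_ublock det_lblock !det1 det_scalar1 !mulr1 mulrC.
Qed.

Section Bordered.

Variables (R : realFieldType) (i : nat).
Variables (A : 'M[R]_i) (a : R) (x y : 'cV[R]_i).

Let M : 'M[R]_(i + 1) := block_mx A x y^T a%:M.
Let C : 'M[R]_i := A - a^-1 *: (x *m y^T).

Let last : 'I_(i + 1) := rshift i ord0.

Lemma principal_minor_lshift (T : {set 'I_i}) :
  principal_minor (lshift 1 @: T) M = principal_minor T A.
Proof.
rewrite -(@det_mxsub_inj _ _ _ (fun j : 'I_#|T| => lshift 1 (enum_val j))).
- by congr (\det _); apply/matrixP => j k; rewrite [LHS]mxE [RHS]mxE block_mxEul.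
- by move=> j k /lshift_inj /enum_val_inj.
- apply/setP => z; apply/imsetP/imsetP => [[j _ ->]|[t tT ->]].
    by exists (enum_val j) => //; apply: enum_valP.
  by exists (enum_rank_in tT t) => //; rewrite enum_rankK_in.
Qed.

(** Listing [T] first and the last index after it makes the submatrix of [M] a
bordered matrix again, whose Schur complement is the [T]-submatrix of [C]. *)
Lemma principal_minor_last (T : {set 'I_i}) :
  a != 0 ->
  principal_minor (last |: lshift 1 @: T) M = a * principal_minor T C.
Proof.
move=> a0; pose e := fun j : 'I_#|T| => enum_val j.
pose f (j : 'I_(#|T| + 1)) : 'I_(i + 1) :=
  match split j with inl t => lshift 1 (e t) | inr u => rshift i u end.
have fl t : f (lshift 1 t) = lshift 1 (e t).
  by rewrite /f -[lshift _ _]/(unsplit (inl t)) unsplitK.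
have fr u : f (rshift _ u) = rshift i u.
  by rewrite /f -[rshift _ u]/(unsplit (inr u)) unsplitK.
rewrite -(@det_mxsub_inj _ _ _ f).
- have -> : mxsub f f M =
      block_mx (mxsub e e A) (rowsub e x) (rowsub e y)^T a%:M.
    apply/matrixP => j k; rewrite mxE.
    case: (split_ordP j) => j' ->; case: (split_ordP k) => k' ->;
      rewrite ?fl ?fr ?block_mxEul ?block_mxEur ?block_mxEdl ?block_mxEdr;
      by rewrite !mxE.
  rewrite det_bordered //; congr (_ * \det _).
  apply/matrixP => j k; rewrite !mxE; congr (_ - _ * _).
  by apply: eq_bigr => l _; rewrite !mxE.
- move=> j k; case: (split_ordP j) => j' ->; case: (split_ordP k) => k' ->;
    rewrite ?fl ?fr.
  + by move/lshift_inj/enum_val_inj->.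
  + by move/eqP; rewrite eq_lrshift.
  + by move/eqP; rewrite eq_rlshift.
  + by move/rshift_inj->.
- apply/setP => z; rewrite !inE; apply/imsetP/orP => [[j _ ->]|].
    case: (split_ordP j) => j' ->; rewrite ?fl ?fr; last first.
      by left; rewrite [j']ord1.
    by right; apply: imset_f; apply: enum_valP.
  case=> [/eqP->|/imsetP[t tT ->]]; first by exists (rshift _ ord0).
  by exists (lshift 1 (enum_rank_in tT t)) => //; rewrite fl /e enum_rankK_in.
Qed.

Lemma lshift_last_cases (S : {set 'I_(i + 1)}) :
  exists T : {set 'I_i},
    S = lshift 1 @: T \/ S = last |: lshift 1 @: T.
Proof.
exists (lshift 1 @^-1: S).
have SE j : (lshift 1 j \in lshift 1 @: (lshift 1 @^-1: S)) = (lshift 1 j \in S).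
  by rewrite mem_imset ?inE //; apply: lshift_inj.
have Sl : last \notin lshift 1 @: (lshift 1 @^-1: S).
  by apply/imsetP => -[j _ /eqP]; rewrite eq_rlshift.
case: (boolP (last \in S)) => lS; [right|left]; apply/setP => z; rewrite ?inE.
  case: (split_ordP z) => j ->; first by rewrite SE eq_lrshift.
  by rewrite [j]ord1 eqxx lS.
case: (split_ordP z) => j ->; first by rewrite SE.
by rewrite [j]ord1 (negbTE lS) (negbTE Sl).
Qed.

Lemma N_matrix_bordered :
  a < 0 -> (N_matrix M <-> N_matrix A /\ P_matrix C).
Proof.
move=> a_lt0; have a0 : a != 0 by rewrite lt_eqF.
split=> [NM|[NA PC] S S0].
  split=> T T0.
    by rewrite -principal_minor_lshift NM // imset_eq0.
  rewrite -(nmulr_rlt0 _ a_lt0) -principal_minor_last //; apply: NM.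
  by apply/set0Pn; exists last; rewrite !inE eqxx.
have [T [ST|ST]] := lshift_last_cases S; rewrite {}ST in S0 *.
  by rewrite principal_minor_lshift NA // -(imset_eq0 (lshift 1)).
rewrite principal_minor_last // nmulr_rlt0 //.
have [->|] := eqVneq T set0; last exact: PC.
by rewrite principal_minor0.
Qed.

End Bordered.

Lemma NCON2_N_matrix_second_category (R : realFieldType) (n : nat)
    (A : 'M[R]_n) :
  NCON2 A -> N_matrix_second_category A.
Proof.
elim=> {n A} [A A_lt0|i A a x y _ [NA A_lt0] a_lt0 x_lt0 y_lt0 PC].
  split=> // S S0.
  rewrite -(@det_mxsub_inj _ _ _ id) ?mxsub_id ?det_mx11 //.
  have [j] := set0Pn _ S0; rewrite [j]ord1 => jS.
  by apply/setP => k; rewrite [k]ord1 jS; apply/imsetP; exists ord0.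
split; first exact/N_matrix_bordered.
move=> j k; case: (split_ordP j) => j' ->; case: (split_ordP k) => k' ->.
- by rewrite block_mxEul.
- by rewrite block_mxEur.
- by rewrite block_mxEdl mxE.
- by rewrite block_mxEdr !ord1 mxE eqxx.
Qed.

Lemma N_matrix_second_category_NCON2 (R : realFieldType) (n : nat)
    (A : 'M[R]_n.+1) :
  N_matrix_second_category A -> NCON2 A.
Proof.
elim: n A => [|n IHn] A; first by case=> _; apply: NCON2_start.
(* The size has to read [n.+1 + 1] for the last row and column to be split off
   as blocks; this is equal to [n.+2], but not convertible to it. *)
move: A; rewrite -[n.+2]addn1 => A [NA A_lt0].
pose a := drsubmx A 0 0; pose x := ursubmx A; pose y := (dlsubmx A)^T.
have AE : A = block_mx (ulsubmx A) x y^T a%:M.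
  by rewrite trmxK -mx11_scalar submxK.
have a_lt0 : a < 0 by rewrite /a !mxE.
rewrite AE in NA *; have [NB PC] := (N_matrix_bordered _ _ _ a_lt0).1 NA.
apply: NCON2_step => //.
- by apply: IHn; split=> // j k; rewrite !mxE.
- by move=> j k; rewrite !mxE.
- by move=> j k; rewrite !mxE.
Qed.

Theorem theorem4p1 (R : realType) (n : nat) (n_gt0 : (0 < n)%N) :
  (forall A : 'M[R]_n, NCON2 A -> N_matrix_second_category A) /\
  (forall A : 'M[R]_n, N_matrix_second_category A -> NCON2 A).
Proof.
split=> A; first exact: NCON2_N_matrix_second_category.
by case: n n_gt0 A => // n _ A; apply: N_matrix_second_category_NCON2.
Qed.
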